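(* For all $n\ge2$, we have $c_n(123,132,213,231)=4$.
   Context: A word $\pi=\pi_1\dots\pi_m$ over the positive integers contains the pattern $\sigma=\sigma_1\dots\sigma_k$ if there are indices $1\le i_1<\dots<i_k\le m$ such that for all $r,s\in\{1,\dots,k\}$: $\pi_{i_r}<\pi_{i_s}$ iff $\sigma_r<\sigma_s$, and $\pi_{i_r}=\pi_{i_s}$ iff $\sigma_r=\sigma_s$; otherwise $\pi$ avoids $\sigma$. $\mathcal{C}_n$ denotes the set of nonnesting permutations: arrangements (words) of the multiset $\{1,1,2,2,\dots,n,n\}$ that avoid the patterns $1221$ and $2112$. For patterns $\sigma,\tau,\dots$, $c_n(\sigma,\tau,\dots)$ is the number of $\pi\in\mathcal{C}_n$ avoiding all of $\sigma,\tau,\dots$. *)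

(* Defs.v *)
From mathcomp Require Import all_boot.

Set Implicit Arguments.
Unset Strict Implicit.
Unset Printing Implicit Defensive.

(* Words are sequences over nat.  Positions are 0-based; the increasing
   function f : 'I_(size s) -> 'I_(size w) is the index choice
   i_1 < ... < i_k. *)
Definition contains (w s : seq nat) : bool :=
  [exists f : {ffun 'I_(size s) -> 'I_(size w)},
    [forall a : 'I_(size s), forall b : 'I_(size s),
      (a < b) ==> (f a < f b)] &&
    [forall a : 'I_(size s), forall b : 'I_(size s),
      ((nth 0 w (f a) < nth 0 w (f b)) == (nth 0 s a < nth 0 s b)) &&
      ((nth 0 w (f a) == nth 0 w (f b)) == (nth 0 s a == nth 0 s b))]].

Definition avoids (w s : seq nat) : bool := ~~ contains w s.

Definition double_multiset (n : nat) : seq nat :=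
  flatten [seq [:: i; i] | i <- iota 1 n].

(* `permutations` enumerates the distinct rearrangements of a sequence,
   without repetition even when the sequence has repeated items. *)
Definition nonnesting (n : nat) : seq (seq nat) :=
  [seq w <- permutations (double_multiset n) |
    avoids w [:: 1; 2; 2; 1] && avoids w [:: 2; 1; 1; 2]].

Definition num_nonnesting_avoiding (n : nat) (pats : seq (seq nat)) : nat :=
  count (fun w => all (avoids w) pats) (nonnesting n).

(* Main.v *)
Require Import Defs.
From mathcomp Require Import all_boot.

(** The four patterns of length 3 are exactly those on three distinct letters
    in which the largest letter does not come first.  So a word avoids them iff
    every subsequence of three distinct letters starts with its largest one.

    For an arrangement of {1,1,...,m,m} with m >= 3 this forces the word to
    begin with m m.  If a letter x < m came first, or second after one copy of
    m, then a copy of m and a copy of some third letter y < m would both follow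
    it, and x, y, m, in the order in which they occur, would form a forbidden
    pattern ([head_is_max], [head_eq_max], [starts_with_double_max]).

    Conversely, putting m m in front of a word with letters below m creates no
    occurrence of any of the six patterns ([pattern_avoiding_double_max]): all
    of them but 2112 start with a letter that is not maximal, which m cannot
    represent, and an occurrence of 2112 that uses a prepended m would need
    another m after its 1s.

    So the avoiders on m letters are the avoiders on m - 1 letters preceded by
    m m ([avoidersS]), and their number is constant from m = 2 on.  For m = 2
    the patterns of length 3 are too long in distinct letters to occur, and 4
    of the 6 arrangements of 1122 avoid 1221 and 2112, which is checked by
    evaluation ([size_avoiders2]). *)

(** * Pattern containment through subsequences *)

Definition order_iso (t s : seq nat) : bool :=
  (size t == size s) &&
  all (fun a => all (fun b =>
      ((nth 0 t a < nth 0 t b) == (nth 0 s a < nth 0 s b)) &&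
      ((nth 0 t a == nth 0 t b) == (nth 0 s a == nth 0 s b)))
    (iota 0 (size s))) (iota 0 (size s)).

Lemma order_isoP (t s : seq nat) :
  reflect (size t = size s /\
           forall a b, a < size s -> b < size s ->
             (nth 0 t a < nth 0 t b) = (nth 0 s a < nth 0 s b) /\
             (nth 0 t a == nth 0 t b) = (nth 0 s a == nth 0 s b))
          (order_iso t s).
Proof.
apply: (iffP andP) => [[/eqP sz /allP H]|[sz H]]; split; rewrite ?sz //.
  move=> a b ha hb; have := H a; rewrite mem_iota ha => /(_ isT)/allP/(_ b).
  by rewrite mem_iota hb => /(_ isT)/andP[/eqP-> /eqP->].
apply/allP => a; rewrite mem_iota => /andP[_ ha].
apply/allP => b; rewrite mem_iota => /andP[_ hb].
by have [-> ->] := H a b ha hb; rewrite !eqxx.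
Qed.

(** A strictly increasing list is determined by its set of entries, so it is
    what remains of the interval after filtering by membership. *)
Lemma increasing_subseq_iota (js : seq nat) (m : nat) :
  sorted ltn js -> (forall j, j \in js -> j < m) -> subseq js (iota 0 m).
Proof.
move=> sjs hm.
suff -> : js = [seq j <- iota 0 m | j \in js] by apply: filter_subseq.
apply: (irr_sorted_eq ltn_trans ltnn) => //.
  by apply: sorted_filter; [apply: ltn_trans | apply: iota_ltn_sorted].
move=> j; rewrite mem_filter mem_iota add0n /=.
by case hj: (j \in js); rewrite //= hm.
Qed.

(** An increasing choice of positions is the same thing as a subsequence of the
    list of all positions, and mapping positions to letters carries it to a
    subsequence of the word. *)
Lemma containsP (w s : seq nat) :
  reflect (exists2 t, subseq t w & order_iso t s) (contains w s).
Proof.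
apply: (iffP existsP) => [[f /andP[/'forall_forallP incr /'forall_forallP iso]]|].
- exists [seq nth 0 w i | i <- [seq (f a : nat) | a <- enum 'I_(size s)]].
    rewrite -[X in subseq _ X](take_size w) -(map_nth_iota0 0 (leqnn _)).
    apply/map_subseq/increasing_subseq_iota; last first.
      by move=> j /mapP[a _ ->]; apply: ltn_ord.
    rewrite sorted_map.
    apply: (@sub_sorted _ (relpre val ltn)); last first.
      by rewrite -sorted_map val_enum_ord iota_ltn_sorted.
    by move=> a b; apply/implyP/incr.
  apply/order_isoP; split; first by rewrite 2!size_map size_enum_ord.
  have nthE c (hc : c < size s) :
      nth 0 [seq nth 0 w i | i <- [seq (f a : nat) | a <- enum 'I_(size s)]] c
        = nth 0 w (f (Ordinal hc)).
    rewrite -map_comp (nth_map (Ordinal hc)) ?size_enum_ord //=.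
    by rewrite (nth_ord_enum (Ordinal hc) (Ordinal hc)).
  move=> a b ha hb; rewrite !nthE.
  by have /andP[/eqP-> /eqP->] := iso (Ordinal ha) (Ordinal hb).
- case=> t /subseqP[m szm ->] /order_isoP[szt iso].
  pose js := mask m (iota 0 (size w)).
  have def_t : mask m w = [seq nth 0 w j | j <- js].
    by rewrite map_mask map_nth_iota0 // take_size.
  have szjs : size js = size s by rewrite -szt def_t size_map.
  have lt_js (a : 'I_(size s)) : nth 0 js a < size w.
    have : nth 0 js a \in js by rewrite mem_nth // szjs.
    by move/mem_mask; rewrite mem_iota.
  have sorted_js : sorted ltn js.
    apply: subseq_sorted (mask_subseq _ _) (iota_ltn_sorted _ _).
    exact: ltn_trans.
  exists [ffun a => Ordinal (lt_js a)]; apply/andP; split.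
    apply/'forall_forallP => a b; apply/implyP => ab; rewrite !ffunE /=.
    by apply: (sorted_ltn_nth ltn_trans) => //; rewrite inE szjs.
  apply/'forall_forallP => a b; rewrite !ffunE /=.
  have [] := iso a b (ltn_ord a) (ltn_ord b).
  by rewrite def_t !(nth_map 0) ?szjs // => -> ->; rewrite !eqxx.
Qed.

Fixpoint sublists (w : seq nat) : seq (seq nat) :=
  if w is x :: w' then map (cons x) (sublists w') ++ sublists w' else [:: [::]].

Lemma mem_sublists (w t : seq nat) : (t \in sublists w) = subseq t w.
Proof.
elim: w t => [|x w IH] t; first by rewrite subseq0 inE.
rewrite /= mem_cat IH; case: t => [|y t]; first by rewrite sub0seq orbT.
case: (eqVneq y x) => [->|neq_yx].
  rewrite mem_map ?IH; last by move=> ? ? [].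
  apply/orP/idP => [[//|]|->]; [exact: cons_subseq | by left].
rewrite [X in X || _](_ : _ = false) //; apply/mapP => -[u _ [/eqP]].
by rewrite (negPf neq_yx).
Qed.

(** This form evaluates, unlike the search through all finite functions in the
    definition of containment; it serves the base case. *)
Lemma containsE (w s : seq nat) :
  contains w s = has (order_iso^~ s) (sublists w).
Proof.
apply/containsP/hasP => [] [t]; rewrite ?mem_sublists => *;
  by exists t; rewrite ?mem_sublists // -mem_sublists.
Qed.

(** * Prepending a largest letter *)

Lemma avoids_behead (x : nat) (w s : seq nat) : avoids (x :: w) s -> avoids w s.
Proof.
apply: contra => /containsP[t sub iso]; apply/containsP; exists t => //.
exact: subseq_trans sub (subseq_cons w x).
Qed.

(** The new letter cannot take part in an occurrence: it would have to play the
    head [c] of the pattern, and a later letter would have to exceed it. *)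
Lemma avoids_cons_max (m c : nat) (w s : seq nat) :
    all (leq^~ m) w -> has (ltn c) s ->
  avoids (m :: w) (c :: s) = avoids w (c :: s).
Proof.
move=> /allP le_m /(has_nthP 0)[j ltj lt_c].
apply/idP/idP; first exact: avoids_behead.
apply: contra => /containsP[t sub iso]; apply/containsP; exists t => //.
case: t sub iso => [|x t] //=; case: eqP => // -> sub /order_isoP[/= [szt] iso].
have [] := iso 0 j.+1 isT ltj; rewrite /= [c < _]lt_c => lt_m _.
have := le_m (nth 0 t j); rewrite (mem_subseq sub) ?mem_nth ?szt //.
by move/(_ isT); rewrite leqNgt lt_m.
Qed.

(** The outer letters of an occurrence of 2112 are equal.  If they are [m], the
    second letter is smaller and hence lies in [w], beyond both prepended
    letters; the last [m] would then also lie in [w], where all letters are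
    smaller. *)
Lemma avoids_2112_double_max (m : nat) (w : seq nat) :
    all (ltn^~ m) w ->
  avoids (m :: m :: w) [:: 2; 1; 1; 2] = avoids w [:: 2; 1; 1; 2].
Proof.
move=> /allP lt_m; apply/idP/idP => [/avoids_behead/avoids_behead//|].
apply: contra => /containsP[t sub iso]; apply/containsP; exists t => //.
case: t sub iso => [|a [|b [|c [|d [|? ?]]]]] // sub /order_isoP[_ iso].
have [/= ba _] := iso 1 0 isT isT.
have [/= _ /eqP ad] := iso 0 3 isT isT; move: sub; rewrite -ad /=.
move: ba; have [->|/negPf neq_am] := eqVneq a m => ba; last by rewrite ?neq_am.
rewrite (ltn_eqF ba) => sub; have /lt_m : m \in w.
  by apply: (mem_subseq sub); rewrite !inE eqxx !orbT.
by rewrite /= ltnn.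
Qed.

Lemma subseq_pair (y z : nat) (w : seq nat) :
  y \in w -> z \in w -> y != z -> subseq [:: y; z] w || subseq [:: z; y] w.
Proof.
move=> /splitPr[p q]; rewrite mem_cat inE => zpq neq.
rewrite eq_sym (negPf neq) /= in zpq; case/orP: zpq => hz.
  apply/orP; right; apply: (cat_subseq (s1 := [:: z]) (s2 := [:: y])).
    by rewrite sub1seq.
  by rewrite sub1seq mem_head.
apply/orP; left; apply: subseq_trans (suffix_subseq p _).
by rewrite /= eqxx sub1seq.
Qed.

(** * The largest letter comes first, twice *)

Definition length3_patterns : seq (seq nat) :=
  [:: [:: 1; 2; 3]; [:: 1; 3; 2]; [:: 2; 1; 3]; [:: 2; 3; 1]].

(** All four comparisons at once, as a rewrite rule to evaluate [order_iso] on
    short explicit words. *)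
Lemma ltn_compare (a b : nat) : a < b ->
  ((a < b) = true) * ((b < a) = false) * ((a == b) = false) * ((b == a) = false).
Proof.
by move=> lt_ab; rewrite lt_ab (gtn_eqF lt_ab) (ltn_eqF lt_ab) ltnNge ltnW.
Qed.

(** Otherwise [z] exceeds both [x] and [y], and [x] followed by [y] and [z] in
    either order is one of the four patterns: 123 or 132 if [x < y], 213 or 231
    if [y < x]. *)
Lemma head_is_max (x y z : nat) (w : seq nat) :
    all (avoids (x :: w)) length3_patterns ->
    y \in w -> z \in w -> y != x -> y < z ->
  z <= x.
Proof.
move=> /and5P[no123 no132 no213 no231 _] yw zw neq_yx lt_yz.
rewrite leqNgt; apply/negP => lt_xz.
have bad s t : avoids (x :: w) s -> subseq t w -> order_iso (x :: t) s -> False.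
  move=> /negP no sub iso; apply: no; apply/containsP.
  by exists (x :: t); rewrite //= eqxx.
have /orP sub := subseq_pair _ _ _ yw zw (negbT (ltn_eqF lt_yz)).
have ltE := (ltn_compare _ _ lt_yz, ltn_compare _ _ lt_xz).
have /orP[lt|lt] : (y < x) || (x < y) by rewrite -neq_ltn.
  case: sub => sub; [apply: (bad _ _ no213 sub) | apply: (bad _ _ no231 sub)];
  by rewrite /order_iso /= !ltnn !eqxx !(ltE, ltn_compare _ _ lt).
case: sub => sub; [apply: (bad _ _ no123 sub) | apply: (bad _ _ no132 sub)];
by rewrite /order_iso /= !ltnn !eqxx !(ltE, ltn_compare _ _ lt).
Qed.

Definition pattern_avoiding (w : seq nat) : bool :=
  [&& avoids w [:: 1; 2; 2; 1], avoids w [:: 2; 1; 1; 2]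
    & all (avoids w) length3_patterns].

Lemma pattern_avoiding_double_max (m : nat) (w : seq nat) :
  all (ltn^~ m) w -> pattern_avoiding (m :: m :: w) = pattern_avoiding w.
Proof.
move=> lt_m; have le_m : all (leq^~ m) w by apply: sub_all lt_m => j /ltnW.
have le_mm : all (leq^~ m) (m :: w) by rewrite /= leqnn.
by rewrite /pattern_avoiding avoids_2112_double_max //= !(avoids_cons_max m).
Qed.

Lemma mem_double_multiset (n i : nat) :
  (i \in double_multiset n) = (0 < i <= n).
Proof.
apply/flatten_mapP/idP => [[j]|hi].
  by rewrite mem_iota add1n ltnS !inE orbb => hj /eqP->.
by exists i; rewrite ?mem_iota ?add1n ?ltnS // mem_head.
Qed.

Lemma perm_double_multisetS (n : nat) :
  perm_eql (double_multiset n.+1) (n.+1 :: n.+1 :: double_multiset n).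
Proof.
apply/permPl; rewrite /double_multiset.
have -> : iota 1 n.+1 = rcons (iota 1 n) n.+1.
  by rewrite -cats1 -[in LHS](addn1 n) iotaD add1n.
rewrite map_rcons flatten_rcons.
by rewrite perm_catC.
Qed.

(** Only the set of letters of [w] matters, not their multiplicities, so that
    this applies both to an arrangement and to what is left of it after one
    copy of the largest letter is removed. *)
Lemma head_eq_max (n : nat) (w : seq nat) :
    2 <= n -> all (avoids w) length3_patterns ->
    (forall i, (i \in w) = (0 < i <= n.+1)) ->
  exists w', w = n.+1 :: w'.
Proof.
move=> hn; case: w => [|x w] ok memw; first by have := memw 1.
have tail i : 0 < i <= n.+1 -> i != x -> i \in w.
  by move=> hi neq; have := memw i; rewrite hi inE (negPf neq).
have /andP[_ le_x] : 0 < x <= n.+1 by rewrite -memw mem_head.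
have [->|neq_x] := eqVneq x n.+1; first by exists w.
(* Since n >= 2, the letters 1 and 2 are below n.+1, and one differs from x. *)
pose y := if x == 1 then 2 else 1.
have [y_gt0 y_le neq_yx] : [/\ 0 < y, y <= n & y != x].
  by rewrite /y; have [->|] := eqVneq x 1; rewrite ?hn ?(ltnW hn) // eq_sym.
have := head_is_max x y n.+1 w ok.
rewrite !tail ?y_gt0 ?(leqW y_le) ?leqnn // 1?eq_sym //.
move=> /(_ isT isT); rewrite eq_sym neq_yx ltnS y_le => /(_ isT isT) ge_x.
by move: neq_x; rewrite eqn_leq le_x ge_x.
Qed.

Lemma starts_with_double_max (n : nat) (w : seq nat) :
    2 <= n -> pattern_avoiding w -> perm_eq w (double_multiset n.+1) ->
  exists w', w = n.+1 :: n.+1 :: w'.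
Proof.
move=> hn /and3P[_ _ ok] pw.
have [i|u def_w] := head_eq_max _ _ hn ok.
  by rewrite (perm_mem pw) mem_double_multiset.
move: pw ok; rewrite {}def_w perm_sym perm_double_multisetS perm_cons perm_sym.
move=> pu ok.
have [||v ->] := head_eq_max n u hn; last by exists v.
  by apply: sub_all ok => s; apply: avoids_behead.
move=> i; rewrite (perm_mem pu) inE mem_double_multiset.
by rewrite [i <= n.+1]leq_eqVlt ltnS; case: eqP => // ->.
Qed.

(** * Counting *)

Definition avoiders (n : nat) : seq (seq nat) :=
  [seq w <- permutations (double_multiset n) | pattern_avoiding w].

Lemma size_avoiders (n : nat) :
  num_nonnesting_avoiding n length3_patterns = size (avoiders n).
Proof.
rewrite /num_nonnesting_avoiding /nonnesting count_filter size_filter.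
by apply: eq_count => w; rewrite /pattern_avoiding inE andbC -andbA.
Qed.

Lemma avoidersS (n : nat) : 2 <= n ->
  perm_eq (avoiders n.+1) [seq n.+1 :: n.+1 :: w | w <- avoiders n].
Proof.
move=> hn; apply: uniq_perm.
- by rewrite filter_uniq ?permutations_uniq.
- by rewrite map_inj_uniq ?filter_uniq ?permutations_uniq // => u v [].
have avoidingS w : w \in permutations (double_multiset n) ->
    pattern_avoiding (n.+1 :: n.+1 :: w) = pattern_avoiding w.
  rewrite mem_permutations => pw; apply: pattern_avoiding_double_max; apply/allP => i.
  by rewrite (perm_mem pw) mem_double_multiset => /andP[].
have permS w : (n.+1 :: n.+1 :: w \in permutations (double_multiset n.+1)) =
    (w \in permutations (double_multiset n)).
  by rewrite !mem_permutations perm_sym perm_double_multisetS !perm_cons perm_sym.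
move=> w; rewrite mem_filter; apply/andP/mapP => [[gw pw]|[v]].
  have [|v def_w] := starts_with_double_max _ _ hn gw.
    by rewrite -mem_permutations.
  exists v => //; move: gw pw; rewrite mem_filter def_w permS => gw pv.
  by rewrite pv -avoidingS ?gw.
by rewrite mem_filter => /andP[gv pv] ->; rewrite permS avoidingS.
Qed.

Lemma size_avoiders2 : size (avoiders 2) = 4.
Proof.
have avoidingE : pattern_avoiding =1 fun w =>
    all (fun s => ~~ has (order_iso^~ s) (sublists w))
        [:: [:: 1; 2; 2; 1], [:: 2; 1; 1; 2] & length3_patterns].
  by move=> w; rewrite /pattern_avoiding /avoids /= !containsE.
by rewrite /avoiders (eq_filter avoidingE); vm_compute.
Qed.

Theorem theorem2p16 (n : nat) (hn : 2 <= n) :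
  num_nonnesting_avoiding n
    [:: [:: 1; 2; 3]; [:: 1; 3; 2]; [:: 2; 1; 3]; [:: 2; 3; 1]] = 4.
Proof.
rewrite (size_avoiders n); elim: n hn => // n IH.
rewrite leq_eqVlt ltnS => /orP[/eqP <-|hn]; first exact: size_avoiders2.
by rewrite (perm_size (avoidersS n hn)) size_map IH.
Qed.
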